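(* $\mathrm{DIAM}(5,3,n)=\Theta(n^2)$.
   Context: A unit $k$-simplex is a set of $k$ points in $\mathbb{R}^d$ any two of which are at Euclidean distance exactly $1$. $\mathrm{DIAM}(d,k,n)$ denotes the maximum, over all sets $P$ of $n$ points in $\mathbb{R}^d$ of diameter $1$ (i.e. $\max_{p,q\in P}\|p-q\|=1$), of the number of $k$-element subsets of $P$ forming a unit $k$-simplex. *)

(* Defs.v *)
From HB Require Import structures.
From mathcomp Require Import all_boot all_order all_algebra.
From mathcomp Require Import boolp classical_sets reals.
Set Implicit Arguments. Unset Strict Implicit. Unset Printing Implicit Defensive.
Import Order.TTheory GRing.Theory Num.Theory.
Local Open Scope ring_scope.

Definition edist (R : realType) (d : nat) (p q : 'rV[R]_d) : R :=
  Num.sqrt (\sum_(i < d) (p ord0 i - q ord0 i) ^+ 2).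

Definition diam_one (R : realType) (d n : nat) (f : 'I_n -> 'rV[R]_d) : Prop :=
  (forall i j, edist (f i) (f j) <= 1) /\ (exists i j, edist (f i) (f j) = 1).

Definition unit_simplex (R : realType) (d n : nat) (f : 'I_n -> 'rV[R]_d)
  (S : {set 'I_n}) : bool :=
  [forall i in S, forall j in S, (i != j) ==> (edist (f i) (f j) == 1)].

Definition n_simplices (R : realType) (d k n : nat) (f : 'I_n -> 'rV[R]_d) : nat :=
  #|[set S : {set 'I_n} | (#|S| == k) && unit_simplex f S]|.

(* DIAM(d,k,n): the maximum (= supremum, the set being finite-valued and bounded
   by 'C(n,k)) over all n-point sets of diameter 1 in R^d. *)
Local Open Scope classical_set_scope.
Definition DIAM (R : realType) (d k n : nat) : R :=
  sup [set x : R | exists f : 'I_n -> 'rV[R]_d,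
         injective f /\ diam_one f /\ x = (n_simplices k f)%:R].

(* Main.v *)
(* Upper bound: call a vertex a of a unit triangle abc "middle" if a sees two other common
   neighbours of b and c in almost opposite directions. By pigeonhole on directions, all but
   boundedly many common neighbours of b and c are middle, so it suffices that the three vertices
   of a triangle are never all middle. For displacements u = a' - a, v = b' - b to other common
   neighbours, diameter 1 gives u.v >= 0; after projecting to the 3-dimensional orthogonal
   complement of the plane abc, the curvature of the unit spheres improves this to
   Pu.Pv = u.v + |u|^2 |v|^2 / 6 > 0. Three almost straight pairs of vectors in dimension 3 whose
   cross products are all positive would have almost orthogonal axes, and the positive combination
   of one pair that is orthogonal to its own axis would be almost orthogonal to all three axes,
   which is impossible.

   Lower bound: the apex (0,0,0,0,s), with s = 1/sqrt 2, is at distance 1 from all points of two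
   orthogonal quarter circles of radius s centred at the origin, which are at distance 1 from each
   other. *)
Require Import Defs.
From HB Require Import structures.
From mathcomp Require Import all_boot all_order all_algebra.
From mathcomp Require Import ring lra zify.
From mathcomp Require Import boolp classical_sets reals.
Set Implicit Arguments. Unset Strict Implicit. Unset Printing Implicit Defensive.
Import Order.TTheory GRing.Theory Num.Theory.
Local Open Scope ring_scope.

(** * Inner products, unit directions and diagonally dominant Gram matrices *)

Section Dot.
Variables (R : realType) (d : nat).
Implicit Types u v w : 'rV[R]_d.

Definition dot u v : R := \sum_(i < d) u ord0 i * v ord0 i.

Lemma dotC u v : dot u v = dot v u.
Proof. by apply: eq_bigr => i _; rewrite mulrC. Qed.

Lemma dotDl u v w : dot (u + v) w = dot u w + dot v w.
Proof. by rewrite -big_split; apply: eq_bigr => i _; rewrite mxE mulrDl. Qed.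

Lemma dotZl k u v : dot (k *: u) v = k * dot u v.
Proof. by rewrite mulr_sumr; apply: eq_bigr => i _; rewrite mxE mulrA. Qed.

Lemma dotNl u v : dot (- u) v = - dot u v.
Proof. by rewrite -scaleN1r dotZl mulN1r. Qed.

Lemma dotDr u v w : dot w (u + v) = dot w u + dot w v.
Proof. by rewrite dotC dotDl !(dotC w). Qed.

Lemma dotZr k u v : dot v (k *: u) = k * dot v u.
Proof. by rewrite dotC dotZl (dotC v). Qed.

Lemma dotNr u v : dot v (- u) = - dot v u.
Proof. by rewrite dotC dotNl (dotC v). Qed.

Definition dotE := (dotDl, dotDr, dotNl, dotNr, dotZl, dotZr).

Lemma dot0l u : dot 0 u = 0.
Proof. by rewrite -(scale0r u) dotZl mul0r. Qed.

Lemma dot_ge0 u : 0 <= dot u u.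
Proof. by apply: sumr_ge0 => i _; rewrite -expr2 sqr_ge0. Qed.

Lemma dot_eq0 u : (dot u u == 0) = (u == 0).
Proof.
apply/idP/eqP => [|->]; last by rewrite dot0l.
rewrite psumr_eq0 => [/allP u0|i _]; last by rewrite -expr2 sqr_ge0.
apply/rowP => i; rewrite mxE; apply/eqP.
by have := u0 i (mem_index_enum _); rewrite implyTb mulf_eq0 orbb.
Qed.

Lemma dot_gt0 u : (0 < dot u u) = (u != 0).
Proof. by rewrite lt_def dot_eq0 dot_ge0 andbT. Qed.

Lemma dot_cauchy u v : dot u v ^+ 2 <= dot u u * dot v v.
Proof.
have [->|v0] := eqVneq v 0; first by rewrite dotC !dot0l expr0n mulr0.
have vv : 0 < dot v v by rewrite dot_gt0.
have := dot_ge0 (dot v v *: u - dot u v *: v).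
rewrite !dotE (dotC v u) => H.
rewrite -(ler_pM2l vv); nra.
Qed.

Lemma dot_le u v c : 0 <= c -> dot u u <= 1 -> dot v v <= c ^+ 2 -> dot u v <= c.
Proof.
move=> c0 uu vv; rewrite leNgt; apply/negP => cuv.
have := dot_cauchy u v; have := dot_ge0 u; have := dot_ge0 v; nra.
Qed.

Definition dir u := (Num.sqrt (dot u u))^-1 *: u.

Lemma edistE u v : edist u v = Num.sqrt (dot (u - v) (u - v)).
Proof. by congr Num.sqrt; apply: eq_bigr => i _; rewrite !mxE expr2. Qed.

Lemma edist_le1 u v : (edist u v <= 1) = (dot (u - v) (u - v) <= 1).
Proof. by rewrite edistE -[leRHS]sqrtr1 ler_sqrt. Qed.

Lemma edist_eq1 u v : (edist u v == 1) = (dot (u - v) (u - v) == 1).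
Proof. by rewrite edistE -[X in _ == X]sqrtr1 eqr_sqrt // ?dot_ge0. Qed.

Lemma dir_unit u : u != 0 -> dot (dir u) (dir u) = 1.
Proof.
rewrite -dot_gt0 => u0; rewrite !dotE mulrA -invfM -expr2 sqr_sqrtr ?ltW //.
by rewrite mulVf ?gt_eqF.
Qed.

Lemma dirN u : dir (- u) = - dir u.
Proof. by rewrite /dir !dotE opprK scalerN. Qed.

(* The sum includes the diagonal term j = i, hence the factor 2. *)
Lemma gram_not_dominant m (v : 'I_m -> 'rV[R]_d) : (d < m)%N ->
  ~ forall i, \sum_(j < m) `|dot (v i) (v j)| < 2 * dot (v i) (v i).
Proof.
move=> dm dom; pose A := \matrix_(i < m) v i.
have kerA : kermx A != 0.
  by rewrite -mxrank_eq0 mxrank_ker subn_eq0 -ltnNge (leq_ltn_trans (rank_leq_col A)).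
(* There are more vectors than dimensions, so some nonzero combination [c] of the [v i] vanishes. *)
pose c := nz_row (kermx A).
have c0 : c != 0 by rewrite nz_row_eq0.
have cA : \sum_j c ord0 j *: v j = 0.
  transitivity (c *m A); last by apply/sub_kermxP; exact: nz_row_sub.
  by rewrite mulmx_sum_row; apply: eq_bigr => j _; rewrite rowK.
have [i0 ci0] : exists i, c ord0 i != 0.
  by apply/existsP; apply: contraNT c0; rewrite negb_exists => /forallP c0;
     apply/eqP/rowP => i; rewrite mxE; apply/eqP; move: (c0 i); rewrite negbK.
(* Pairing this relation with the [v i] of largest coefficient contradicts dominance in row [i]. *)
have [i _ maxi] := @Order.TotalTheory.arg_maxP _ _ _ i0 xpredT (fun j => `|c ord0 j|) isT.
have ci : 0 < `|c ord0 i| by rewrite (lt_le_trans _ (maxi i0 isT)) ?normr_gt0.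
have sum0 : \sum_j c ord0 j * dot (v i) (v j) = 0.
  transitivity (dot (v i) (\sum_j c ord0 j *: v j)).
    have dotS (I : Type) (r : seq I) F :
        dot (v i) (\sum_(k <- r) F k) = \sum_(k <- r) dot (v i) (F k).
      by elim/big_rec2: _ => [|k x y _ <-]; rewrite ?dotDr // dotC dot0l.
    by rewrite dotS; apply: eq_bigr => j _; rewrite dotZr.
  by rewrite cA dotC dot0l.
have := dom i; rewrite (bigD1 i) //= ger0_norm ?dot_ge0 // mulr2n mulrDl mul1r ltrD2l.
rewrite -(ltr_pM2l ci) mulr_sumr ltNge => /negP; apply.
move: sum0; rewrite (bigD1 i) //= => /eqP; rewrite addr_eq0 => /eqP sum0.
rewrite -[X in _ * X]ger0_norm ?dot_ge0 // -normrM sum0 normrN.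
apply: le_trans (ler_norm_sum _ _ _) _; apply: ler_sum => j _.
rewrite normrM ler_wpM2r //; exact: maxi.
Qed.

End Dot.

(** * Pairs of vectors that nearly cancel *)

Section NearlyStraightPairs.
Variables (R : realType) (d : nat).

(** One Gram-Schmidt step. The residual is the shortest vector [x false + t *: x true], hence no
    longer than the one at [t = 1]; squared norms of at least 2/3 force [s >= 1/2]. *)
Lemma orth_combination (x : bool -> 'rV[R]_d) :
    (forall i, 2/3 <= dot (x i) (x i)) ->
    dot (x true + x false) (x true + x false) <= (1/10) ^+ 2 ->
  exists2 s, 1/2 <= s &
    let x' := x false + s *: x true in dot x' (x true) = 0 /\ dot x' x' <= (1/10) ^+ 2.
Proof.
move=> xn xs; have A := xn true; have C := xn false.
move: xs; rewrite !dotE (dotC (x false) (x true)).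
set a := dot (x true) _ in A *; set b := dot (x true) (x false); set c := dot _ _ in C *.
move=> xs; have a0 : a != 0 by rewrite gt_eqF //; lra.
exists (- b / a); first by rewrite ler_pdivlMr; lra.
rewrite /= !dotE (dotC (x false) (x true)) -/a -/b -/c; split; first by field.
(* This is the excess of the squared length at [t = 1] over its minimum. *)
have : 0 <= (a + b) ^+ 2 / a by rewrite divr_ge0 ?sqr_ge0 //; lra.
suff -> : (a + b) ^+ 2 / a = a + b + (b + c) -
  (c + - b / a * b + (- b / a * b + - b / a * (- b / a * a))) by lra.
by field.
Qed.

(** Cauchy-Schwarz bounds the sum of the two positive products, hence each of them. *)
Lemma dot_le_of_pos x (y : bool -> 'rV[R]_d) i :
    dot x x <= 1 -> dot (y true + y false) (y true + y false) <= (1/10) ^+ 2 ->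
  (forall j, 0 < dot x (y j)) -> dot x (y i) <= 1/10.
Proof.
move=> xx ys xy; have := @dot_le R d x (y true + y false) (1/10).
move=> /(_ _ xx ys) H; have {H} : dot x (y true + y false) <= 1/10 by apply: H; lra.
by rewrite dotDr; have := xy true; have := xy false; case: i => *; lra.
Qed.

(** Cauchy-Schwarz on the residual [y false + t *: y true] gives 1/10, and [t >= 1/2] turns this
    into 1/5. *)
Lemma dot_le_of_pos_unit (h : 'rV[R]_d) (y : bool -> 'rV[R]_d) :
    dot h h = 1 ->
    (forall i, 2/3 <= dot (y i) (y i)) ->
    dot (y true + y false) (y true + y false) <= (1/10) ^+ 2 ->
    (forall j, 0 < dot h (y j)) ->
  dot h (y true) <= 1/5.
Proof.
move=> hh yn ys hy; have [t t2 /= [_ ny']] := orth_combination yn ys.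
have := @dot_le R d h (y false + t *: y true) (1/10).
rewrite hh => /(_ _ (lexx _) ny') H.
have {H} : dot h (y false + t *: y true) <= 1/10 by apply: H; lra.
rewrite dotDr dotZr; have := hy true; have := hy false; nra.
Qed.

End NearlyStraightPairs.

(* The Gram matrix of p, q, x true, y true, z true and of the normalized combination of
   x true and x false orthogonal to x true would be diagonally dominant. *)
Lemma no_three_near_lines (R : realType) (p q : 'rV[R]_5) (x y z : bool -> 'rV[R]_5) :
    let sum_small w := dot (w true + w false) (w true + w false) <= (1/10) ^+ 2 in
    let positive (v w : bool -> 'rV[R]_5) := forall i j, 0 < dot (v i) (w j) in
    let admissible w := forall i,
      [/\ dot (w i) p = 0, dot (w i) q = 0, 2/3 <= dot (w i) (w i) & dot (w i) (w i) <= 1] in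
    dot p p = 1 -> dot q q = 1 -> dot p q = 1/2 ->
    admissible x -> admissible y -> admissible z ->
    sum_small x -> sum_small y -> sum_small z ->
    positive x y -> positive x z -> positive y z ->
  False.
Proof.
move=> sum_small positive admissible pp qq pq ax ay az sx sy sz xy xz yz.
have nx i : 2/3 <= dot (x i) (x i) by case: (ax i).
have ny i : 2/3 <= dot (y i) (y i) by case: (ay i).
have nz i : 2/3 <= dot (z i) (z i) by case: (az i).
have [s s2 /=] := orth_combination nx sx.
set x' := _ + _ => -[x'x _].
(* Both coefficients of [x'], namely 1 and [s], are positive. *)
have x'pos w : positive x w -> forall j, 0 < dot x' (w j).
  by move=> xw j; rewrite dotDl dotZl; have := xw true j; have := xw false j; nra.
have x'0 : x' != 0.
  by apply/eqP => E; have := x'pos _ xy true; rewrite E dot0l ltxx.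
have hpos w : positive x w -> forall j, 0 < dot (dir x') (w j).
  by move=> xw j; rewrite dotZl mulr_gt0 ?x'pos // invr_gt0 sqrtr_gt0 dot_gt0.
have hh := dir_unit x'0.
have hy := dot_le_of_pos_unit hh ny sy (hpos _ xy).
have hz := dot_le_of_pos_unit hh nz sz (hpos _ xz).
have hx : dot (dir x') (x true) = 0 by rewrite dotZl x'x mulr0.
have [xp xq _ x1] := ax true; have [yp yq _ y1] := ay true; have [zp zq _ _] := az true.
have [xfp xfq _ _] := ax false.
have hp : dot (dir x') p = 0 by rewrite !dotE xp xfp !(mulr0, addr0).
have hq : dot (dir x') q = 0 by rewrite !dotE xq xfq !(mulr0, addr0).
have cxy := dot_le_of_pos true x1 sy (xy true).
have cxz := dot_le_of_pos true x1 sz (xz true).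
have cyz := dot_le_of_pos true y1 sz (yz true).
have := hpos _ xy true; have := hpos _ xz true.
have := xy true true; have := xz true true; have := yz true true.
have := nx true; have := ny true; have := nz true.
move: xp xq yp yq zp zq hx hy hz hp hq hh cxy cxz cyz x1 y1.
move: (x true) (y true) (z true) (dir x') => X Y Z h.
move=> xp xq yp yq zp zq hx hy hz hp hq hh cxy cxz cyz X1 Y1 nZ nY nX pYZ pXZ pXY phZ phY.
pose v (i : 'I_6) : 'rV[R]_5 := nth 0 [:: p; q; X; Y; Z; h] i.
apply: (@gram_not_dominant R 5 6 v isT).
have abs0 (a b : 'rV[R]_5) : dot a b = 0 -> `|dot a b| = 0 by move=> ->; rewrite normr0.
have absp (a b : 'rV[R]_5) : 0 < dot a b -> `|dot a b| = dot a b by move=> /ltW/ger0_norm.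
have absn (a : 'rV[R]_5) : `|dot a a| = dot a a by rewrite ger0_norm ?dot_ge0.
have hpq : `|dot p q| = 1/2 by rewrite absp pq //; lra.
(* The off-diagonal row sums are 1/2 for [p] and [q], at most 1/5 for [X] and at most 2/5 for [Y],
   [Z] and [h]; the diagonal entries are 1 or at least 2/3. *)
case=> -[|[|[|[|[|[|//]]]]]] /= i6; rewrite !big_ord_recl big_ord0 /v /=.
all: rewrite ?(dotC p X) ?(dotC p Y) ?(dotC p Z) ?(dotC p h) ?(dotC q p).
all: rewrite ?(dotC q X) ?(dotC q Y) ?(dotC q Z) ?(dotC q h).
all: rewrite ?(dotC X h) ?(dotC Y X) ?(dotC Y h) ?(dotC Z X) ?(dotC Z Y) ?(dotC Z h).
all: rewrite ?(abs0 _ _ xp) ?(abs0 _ _ xq) ?(abs0 _ _ yp) ?(abs0 _ _ yq).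
all: rewrite ?(abs0 _ _ zp) ?(abs0 _ _ zq) ?(abs0 _ _ hp) ?(abs0 _ _ hq) ?(abs0 _ _ hx).
all: rewrite ?absn ?hpq ?(absp _ _ pXY) ?(absp _ _ pXZ) ?(absp _ _ pYZ).
all: rewrite ?(absp _ _ phY) ?(absp _ _ phZ).
all: lra.
Qed.

(** * Projection to the orthogonal complement of the plane of a triangle *)

Definition near_opposite (R : realType) (d : nat) (u v : 'rV[R]_d) : bool :=
  dot (dir u + dir v) (dir u + dir v) <= (1/10) ^+ 2.

Section Shadow.
Variables (R : realType) (d : nat).
Implicit Types (u v m : 'rV[R]_d).

(* If u joins a vertex of a unit triangle to another common neighbour of the opposite edge and m is
   the sum of the two edge vectors at that vertex, the component of u in the plane of the triangle
   is - |u|^2 / 3 *: m, so that |u| *: shadow m u is the orthogonal projection of u to the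
   complement of this plane. *)
Definition shadow m u := dir u + (Num.sqrt (dot u u) / 3) *: m.

Lemma dot_dir u v : dot (dir u) v = dot u v / Num.sqrt (dot u u).
Proof. by rewrite dotZl mulrC. Qed.

Lemma sqrt_dot_gt0 u : u != 0 -> 0 < Num.sqrt (dot u u).
Proof. by rewrite sqrtr_gt0 dot_gt0. Qed.

Lemma shadow_orth m u e : u != 0 ->
  dot u e = - (dot u u * dot m e) / 3 -> dot (shadow m u) e = 0.
Proof.
move=> u0 ue; rewrite dotDl dot_dir ue dotZl -[dot u u]sqr_sqrtr ?dot_ge0 //.
rewrite sqrtr_sqr ger0_norm ?sqrtr_ge0 //.
by have := sqrt_dot_gt0 u0; set l := Num.sqrt _ => l0; field; rewrite gt_eqF.
Qed.

Lemma dir_normal m u : u != 0 -> dot u m = - dot u u ->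
  dot (dir u) m = - Num.sqrt (dot u u).
Proof.
move=> u0 um; rewrite dot_dir um -{1}[dot u u]sqr_sqrtr ?dot_ge0 //.
by have := sqrt_dot_gt0 u0; set l := Num.sqrt _ => l0; field; rewrite gt_eqF.
Qed.

(** Pythagoras: the removed component has squared length |u|^2 / 3. For |u| <= 1 this leaves at
    least 2/3, the lower bound required in [no_three_near_lines]. *)
Lemma dot_shadow m u : u != 0 -> dot m m = 3 -> dot u m = - dot u u ->
  dot (shadow m u) (shadow m u) = 1 - dot u u / 3.
Proof.
move=> u0 mm um; rewrite /shadow; move: (dir_normal u0 um) (dir_unit u0).
move: (dir u) => e em ee; rewrite !dotE mm (dotC m) em ee.
rewrite -[dot u u]sqr_sqrtr ?dot_ge0 // sqrtr_sqr ger0_norm ?sqrtr_ge0 //.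
by field.
Qed.

(** Projection shortens: the squared length of the sum drops by (|u| + |v|)^2 / 3. *)
Lemma shadow_near_opposite m u v : u != 0 -> v != 0 -> dot m m = 3 ->
    dot u m = - dot u u -> dot v m = - dot v v -> near_opposite u v ->
  dot (shadow m u + shadow m v) (shadow m u + shadow m v) <= (1/10) ^+ 2.
Proof.
move=> u0 v0 mm um vm; rewrite /near_opposite /shadow.
move: (dir_normal u0 um) (dir_normal v0 vm).
move: (dir u) (dir v) => e e'; rewrite !dotE !(dotC m) mm (dotC e' e).
move: (Num.sqrt _) (Num.sqrt _) => l l' -> -> H.
have := sqr_ge0 (l + l'); nra.
Qed.

(** Being orthogonal to [m'], the first shadow sees only [dir v]. To the nonnegative product of the
    directions, the correction along [m] adds |u| m.v / (3 |v|), the gain from curvature. *)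
Lemma dot_shadow_gt0 m m' u v : u != 0 -> v != 0 ->
    dot u m' = - (dot u u * dot m m') / 3 ->
  0 <= dot u v -> 0 < dot m v -> 0 < dot (shadow m u) (shadow m' v).
Proof.
move=> u0 v0 um' uv mv; rewrite [shadow m' v]/shadow dotDr [dot _ (_ *: m')]dotZr.
rewrite (shadow_orth u0 um') mulr0 addr0.
rewrite dotC dot_dir divr_gt0 ?sqrt_dot_gt0 // dotC dotDl [dot (_ *: m) _]dotZl.
rewrite ltr_wpDl // ?mulr_gt0 // ?divr_gt0 ?sqrt_dot_gt0 ?invr_gt0 ?ltr0n //.
by rewrite dot_dir divr_ge0 ?sqrtr_ge0.
Qed.

End Shadow.

(* For a triangle abc, p = a - b, q = a - c, and u, v, w are displacements from a, b, c. *)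
Lemma no_triangle_three_near_opposite (R : realType) (p q : 'rV[R]_5)
    (u v w : bool -> 'rV[R]_5) :
    dot p p = 1 -> dot q q = 1 -> dot p q = 1/2 ->
    (forall i, [/\ 0 < dot (u i) (u i), dot (u i) (u i) <= 1,
       dot (u i) p = - dot (u i) (u i) / 2 & dot (u i) q = - dot (u i) (u i) / 2]) ->
    (forall i, [/\ 0 < dot (v i) (v i), dot (v i) (v i) <= 1,
       dot (v i) p = dot (v i) (v i) / 2 & dot (v i) q = 0]) ->
    (forall i, [/\ 0 < dot (w i) (w i), dot (w i) (w i) <= 1,
       dot (w i) p = 0 & dot (w i) q = dot (w i) (w i) / 2]) ->
    (forall i j, 0 <= dot (u i) (v j)) -> (forall i j, 0 <= dot (u i) (w j)) ->
    (forall i j, 0 <= dot (v i) (w j)) ->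
    near_opposite (u true) (u false) -> near_opposite (v true) (v false) ->
    near_opposite (w true) (w false) ->
  False.
Proof.
move=> pp qq pq Hu Hv Hw uv uw vw nu nv nw.
(* The sums of the two edge vectors at a, b and c, using b - c = q - p. *)
pose mu := p + q; pose mv := q - 2 *: p; pose mw := p - 2 *: q.
have nonzero (t : 'rV[R]_5) : 0 < dot t t -> t != 0 by rewrite dot_gt0.
have mp : (dot mu p = 3/2) * (dot mu q = 3/2) * (dot mv p = -3/2) *
    (dot mv q = 0) * (dot mw p = 0) * (dot mw q = -3/2).
  by rewrite /mu /mv /mw !dotE (dotC q p) pp qq pq; do !split; lra.
have mm : (dot mu mu = 3) * (dot mv mv = 3) * (dot mw mw = 3).
  by rewrite /mu /mv /mw !dotE (dotC q p) pp qq pq; do !split; lra.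
have mx : (dot mu mv = -3/2) * (dot mu mw = -3/2) * (dot mv mw = -3/2).
  by rewrite /mu /mv /mw !dotE (dotC q p) pp qq pq; do !split; lra.
pose f m (t : bool -> 'rV[R]_5) i := shadow m (t i).
apply: (@no_three_near_lines R p q (f mu u) (f mv v) (f mw w)) => //.
- move=> i; have [t0 t1 tp tq] := Hu i; have tn := nonzero _ t0.
  have tm : dot (u i) mu = - dot (u i) (u i) by rewrite /mu !dotE; lra.
  by split; [apply: shadow_orth | apply: shadow_orth | rewrite dot_shadow | rewrite dot_shadow];
    rewrite ?mp ?mm //; lra.
- move=> i; have [t0 t1 tp tq] := Hv i; have tn := nonzero _ t0.
  have tm : dot (v i) mv = - dot (v i) (v i) by rewrite /mv !dotE; lra.
  by split; [apply: shadow_orth | apply: shadow_orth | rewrite dot_shadow | rewrite dot_shadow];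
    rewrite ?mp ?mm //; lra.
- move=> i; have [t0 t1 tp tq] := Hw i; have tn := nonzero _ t0.
  have tm : dot (w i) mw = - dot (w i) (w i) by rewrite /mw !dotE; lra.
  by split; [apply: shadow_orth | apply: shadow_orth | rewrite dot_shadow | rewrite dot_shadow];
    rewrite ?mp ?mm //; lra.
- have [t0 _ tp tq] := Hu true; have [s0 _ sp sq] := Hu false.
  by apply: shadow_near_opposite; rewrite ?mm ?nonzero // /mu !dotE; lra.
- have [t0 _ tp tq] := Hv true; have [s0 _ sp sq] := Hv false.
  by apply: shadow_near_opposite; rewrite ?mm ?nonzero // /mv !dotE; lra.
- have [t0 _ tp tq] := Hw true; have [s0 _ sp sq] := Hw false.
  by apply: shadow_near_opposite; rewrite ?mm ?nonzero // /mw !dotE; lra.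
- move=> i j; have [t0 _ tp tq] := Hu i; have [s0 _ sp sq] := Hv j.
  apply: dot_shadow_gt0; rewrite ?mx ?nonzero ?uv //; first by rewrite /mv !dotE; lra.
  by rewrite dotC /mu !dotE; lra.
- move=> i j; have [t0 _ tp tq] := Hu i; have [s0 _ sp sq] := Hw j.
  apply: dot_shadow_gt0; rewrite ?mx ?nonzero ?uw //; first by rewrite /mw !dotE; lra.
  by rewrite dotC /mu !dotE; lra.
- move=> i j; have [t0 _ tp tq] := Hv i; have [s0 _ sp sq] := Hw j.
  apply: dot_shadow_gt0; rewrite ?mx ?nonzero ?vw //; first by rewrite /mw !dotE; lra.
  by rewrite dotC /mv !dotE; lra.
Qed.

(** * All but boundedly many points of a set are middle *)

Section Middle.
Variables (R : realType) (d n : nat) (f : 'I_n -> 'rV[R]_d).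

Definition middle (A : {set 'I_n}) (k : 'I_n) : bool :=
  [exists h in A :\ k, exists j in A :\ k, near_opposite (f h - f k) (f j - f k)].

End Middle.

(** Cut the cube [-1, 1]^d into cells of side 1/N. In a common cell each squared coordinate
    difference is at most 1/N^2 <= 1/N, and d/N < e by the choice of [N]. *)
Lemma direction_coloring (R : realType) (d : nat) (e : R) : 0 < e ->
  exists (C : finType) (col : 'rV[R]_d -> C), forall u v, col u = col v ->
    dot (dir u - dir v) (dir u - dir v) <= e.
Proof.
move=> e0.
pose N := (Num.trunc (d%:R / e)).+1.
have NE : d%:R / e < N%:R by rewrite /N truncnS_gt.
(* On [-1, 1] the index runs from 0 to [2 * N], the last value only at 1; by [trunc_lt] below,
   [inord] never takes its default. *)
pose cell (x : R) : 'I_(2 * N).+1 := inord (Num.trunc ((x + 1) * N%:R)).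
exists {ffun 'I_d -> 'I_(2 * N).+1}, (fun u => [ffun i => cell (dir u ord0 i)]).
move=> u v /ffunP uv.
have bound (t : 'rV[R]_d) i : -1 <= dir t ord0 i <= 1.
  have : dir t ord0 i ^+ 2 <= 1.
    have [->|t0] := eqVneq t 0; first by rewrite !mxE mulr0 expr0n ler01.
    rewrite -(dir_unit t0) /dot (bigD1 i) //= -expr2 lerDl.
    by apply: sumr_ge0 => j _; rewrite -expr2 sqr_ge0.
  nra.
have N0 : 0 < N%:R :> R by rewrite ltr0n.
have pos (t : 'rV[R]_d) i : 0 <= (dir t ord0 i + 1) * N%:R.
  by apply: mulr_ge0; [have := bound t i; lra | exact: ltW].
have trunc_lt (t : 'rV[R]_d) i : (Num.trunc ((dir t ord0 i + 1) * N%:R) < (2 * N).+1)%N.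
  rewrite ltnS -(ler_nat R) natrM (le_trans (_ : _ <= (dir t ord0 i + 1) * N%:R)) //.
    by rewrite truncn_le.
  by rewrite ler_pM2r //; have := bound t i; lra.
have close i : (dir u - dir v) ord0 i * (dir u - dir v) ord0 i <= N%:R^-1.
  have -> : (dir u - dir v) ord0 i = dir u ord0 i - dir v ord0 i by rewrite !mxE.
  have := uv i; rewrite !ffunE => /(congr1 val); rewrite /= !inordK //.
  have := truncn_itv (pos u i); have := truncn_itv (pos v i).
  move: (dir u ord0 i) (dir v ord0 i) => x y; move: (Num.trunc _) (Num.trunc _) => k l.
  move=> /andP[ky yk] /andP[lx xl] E; move: ky yk lx xl; rewrite {}E -natr1 => ky yk lx xl.
  have N1 : 1 <= N%:R :> R by rewrite ler1n.
  rewrite -div1r ler_pdivlMr //.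
  have zz : ((x - y) * N%:R) ^+ 2 <= 1.
    have z1 : -1 <= (x - y) * N%:R by lra.
    have z2 : (x - y) * N%:R <= 1 by lra.
    by nra.
  apply: le_trans zz; rewrite expr2 mulrACA; apply: ler_wpM2l; last by rewrite ler_peMl.
  by rewrite -expr2 sqr_ge0.
apply: le_trans (ler_sum _ (fun i _ => close i)) _.
rewrite sumr_const card_ord -[_ *+ d]mulr_natr mulrC ler_pdivrMr //.
by rewrite mulrC -ler_pdivrMr // ltW.
Qed.

(* As in the Erdos-Szekeres argument, label each point by the set of colours of the directions
   arriving from earlier points: if i < j have the same label, some h < i has h -> i of the colour of
   i -> j, so that i is middle. *)
Lemma card_nonmiddle (R : realType) (d : nat) : exists K : nat, (0 < K)%N /\
  forall n (f : 'I_n -> 'rV[R]_d) (A : {set 'I_n}),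
    (#|[set k in A | ~~ middle f A k]| <= K)%N.
Proof.
have e0 : 0 < (1/10) ^+ 2 :> R by rewrite exprn_gt0 //; lra.
have [C [col colP]] := direction_coloring d e0.
exists #|{set C}|; split; first by apply/card_gt0P; exists finset.set0.
move=> n f A; set B := finset _.
pose In (j : 'I_n) : {set C} := [set col (f j - f i) | i in B & (i < j)%N].
suff InI : {in B &, injective In} by rewrite -(card_in_imset InI) max_card.
have lt_neq i j : i \in B -> j \in B -> (i < j)%N -> In i <> In j.
  move=> iB jB ij InE.
  have : col (f j - f i) \in In i.
    by rewrite InE; apply/imsetP; exists i => //; move: iB; rewrite !inE ij andbT.
  case/imsetP => h; rewrite !inE => /andP[/andP[hA _] hi] E.
  move: iB jB; rewrite !inE => /andP[iA /negP mid] /andP[jA _]; apply: mid.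
  apply/existsP; exists j; rewrite !inE jA andbT neq_ltn ij orbT /=.
  apply/existsP; exists h; rewrite !inE hA andbT neq_ltn hi /=.
  (* Reversing the arriving direction h -> i turns equality of colours into near opposition at i. *)
  by rewrite /near_opposite -[f h - f i]opprB dirN; apply: colP.
move=> i j iB jB InE; case: (ltngtP i j) => [ij|ji|/ord_inj //].
  by case: (lt_neq i j).
by case: (lt_neq j i).
Qed.

Lemma card3_set (T : finType) (S : {set T}) : #|S| = 3 ->
  exists i j k, [/\ i != j, i != k, j != k & S = [set i; j; k]].
Proof.
move=> S3; have [k kS] : exists k, k \in S by apply/card_gt0P; rewrite S3.
have /cards2P[i [j [ij Sk]]] : #|S :\ k| == 2 by have := cardsD1 k S; rewrite kS S3; lia.
have [] : i \in S :\ k /\ j \in S :\ k by rewrite Sk !inE !eqxx orbT.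
rewrite !inE => /andP[ik _] /andP[jk _]; exists i, j, k; split=> //.
by rewrite -Sk finset.setUC finset.setD1K.
Qed.

(** * Counting unit triangles in dimension 5 *)

Section Triangles.
Variables (R : realType) (n : nat) (f : 'I_n -> 'rV[R]_5).
Hypotheses (f_inj : injective f) (f_diam : forall i j, dot (f i - f j) (f i - f j) <= 1).

Definition unit_pair i j : bool := dot (f i - f j) (f i - f j) == 1.

Definition common_nbrs i j : {set 'I_n} := [set k | unit_pair k i && unit_pair k j].

Lemma unit_pairC i j : unit_pair i j = unit_pair j i.
Proof. by rewrite /unit_pair -(opprB (f j)) dotNl dotNr opprK. Qed.

Lemma middle_witness (A : {set 'I_n}) k : middle f A k ->
  exists h : bool -> 'I_n, (forall b, h b \in A /\ h b != k) /\
    near_opposite (f (h true) - f k) (f (h false) - f k).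
Proof.
case/existsP => h /andP[]; rewrite !inE => /andP[hk hA] /existsP[j] /andP[].
rewrite !inE => /andP[jk jA] near; exists (fun b => if b then h else j).
by split=> // -[].
Qed.

(** Both [f i] and [f a] lie on the unit spheres about [f j] and [f k]; expand |u + e|^2 = |e|^2 for
    each edge vector [e] at [f i]. *)
Lemma common_nbr_dot i j k (a : 'I_n) : unit_pair i j -> unit_pair i k ->
    a \in common_nbrs j k -> a != i -> let u := f a - f i in
  [/\ 0 < dot u u, dot u u <= 1, dot u (f i - f j) = - dot u u / 2
    & dot u (f i - f k) = - dot u u / 2].
Proof.
move=> /eqP ij /eqP ik; rewrite inE => /andP[/eqP aj /eqP ak] ai u.
have half (v e : 'rV[R]_5) :
    dot e e = 1 -> dot (v + e) (v + e) = 1 -> dot v e = - dot v v / 2.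
  by move=> e1; rewrite !dotE e1 (dotC e v); lra.
rewrite dot_gt0 subr_eq0 (inj_eq f_inj) ai f_diam; split=> //; apply: half => //.
all: by rewrite /u addrA subrK.
Qed.

(** By polarization the product is (1 + 1 - 1 - |f a - f b|^2) / 2, which diameter 1 makes
    nonnegative. *)
Lemma common_nbr_cross i j (a b : 'I_n) : unit_pair i j -> unit_pair a j -> unit_pair i b ->
  0 <= dot (f a - f i) (f b - f j).
Proof.
move=> /eqP ij /eqP aj /eqP ib; have := f_diam a b.
have -> : dot (f a - f i) (f b - f j) =
  (dot (f a - f j) (f a - f j) + dot (f i - f b) (f i - f b) - dot (f i - f j) (f i - f j)
   - dot (f a - f b) (f a - f b)) / 2.
  by rewrite !dotE !(dotC _ (f a)) (dotC (f j) (f i)) !(dotC (f b)); field.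
by rewrite aj ib ij; lra.
Qed.

Lemma triangle_nonmiddle i j k : unit_pair i j -> unit_pair i k -> unit_pair j k ->
  [|| ~~ middle f (common_nbrs j k) i, ~~ middle f (common_nbrs i k) j
    | ~~ middle f (common_nbrs i j) k].
Proof.
move=> ij ik jk; rewrite -!negb_and; apply/negP => /and3P[mi mj mk].
have [a [Ha na]] := middle_witness mi.
have [b [Hb nb]] := middle_witness mj.
have [c [Hc nc]] := middle_witness mk.
have ji : unit_pair j i by rewrite unit_pairC.
have ki : unit_pair k i by rewrite unit_pairC.
have kj : unit_pair k j by rewrite unit_pairC.
have Na t : unit_pair (a t) j /\ unit_pair (a t) k by case: (Ha t); rewrite inE => /andP.
have Nb t : unit_pair i (b t) /\ unit_pair (b t) k.
  by case: (Hb t); rewrite inE unit_pairC => /andP.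
have Nc t : unit_pair i (c t) /\ unit_pair j (c t).
  by case: (Hc t); rewrite inE !(unit_pairC (c t)) => /andP.
pose p := f i - f j; pose q := f i - f k.
have jE : f j - f i = - p by rewrite opprB.
have kE : f k - f i = - q by rewrite opprB.
have jkE : f j - f k = q - p by rewrite /p /q opprB [in RHS]addrC addrA subrK.
have kjE : f k - f j = p - q by rewrite -opprB jkE opprB.
have pp : dot p p = 1 by exact/eqP.
have qq : dot q q = 1 by exact/eqP.
have [pE qE] : f i - f j = p /\ f i - f k = q by [].
clearbody p q.
have pq : dot p q = 1/2.
  by move: jk => /eqP; rewrite jkE !dotE pp qq (dotC q p); lra.
apply: (@no_triangle_three_near_opposite R p q (fun t => f (a t) - f i)
  (fun t => f (b t) - f j) (fun t => f (c t) - f k)) => //.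
- by move=> t; have [? ?] := Ha t; rewrite -pE -qE; apply: common_nbr_dot.
- move=> t; have [bN bj] := Hb t.
  have := common_nbr_dot ji jk bN bj; rewrite /= jE jkE; move: (f (b t) - f j) => u [? ?].
  by rewrite dotDr dotNr => ? ?; split=> //; lra.
- move=> t; have [cN ck] := Hc t.
  have := common_nbr_dot ki kj cN ck; rewrite /= kE kjE; move: (f (c t) - f k) => u [? ?].
  by rewrite dotDr dotNr => ? ?; split=> //; lra.
- by move=> s t; apply: common_nbr_cross => //; [case: (Na s) | case: (Nb t)].
- by move=> s t; apply: common_nbr_cross => //; [case: (Na s) | case: (Nc t)].
- by move=> s t; apply: common_nbr_cross => //; [case: (Nb s) | case: (Nc t)].
Qed.

Lemma unit_simplex_pair (S : {set 'I_n}) i j : unit_simplex f S ->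
  i \in S -> j \in S -> i != j -> unit_pair i j.
Proof.
move=> /forallP/(_ i)/implyP + iS => /(_ iS)/forallP/(_ j)/implyP + jS ij.
by move=> /(_ jS); rewrite ij /= edist_eq1.
Qed.

(** Charge each triangle to the edge opposite a nonmiddle vertex: each of the n^2 ordered pairs is
    charged at most [K] times. *)
Lemma n_triangles_le (K : nat) :
    (forall A : {set 'I_n}, (#|[set k in A | ~~ middle f A k]| <= K)%N) ->
  (n_simplices 3 f <= K * n ^ 2)%N.
Proof.
move=> HK; pose M (t : 'I_n * 'I_n) :=
  [set k in common_nbrs t.1 t.2 | ~~ middle f (common_nbrs t.1 t.2) k].
pose T := [set t : ('I_n * 'I_n) * 'I_n | t.2 \in M t.1].
pose g (t : ('I_n * 'I_n) * 'I_n) := [set t.1.1; t.1.2; t.2].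
have sub : [set S : {set 'I_n} | (#|S| == 3) && unit_simplex f S] \subset g @: T.
  apply/fintype.subsetP => S; rewrite inE => /andP[/eqP/card3_set[i [j [k [ij ik jk ->]]]] uS].
  have [uij uik ujk] : [/\ unit_pair i j, unit_pair i k & unit_pair j k].
    by split; apply: (unit_simplex_pair uS); rewrite ?inE ?eqxx ?orbT.
  have uC := unit_pairC.
  case/or3P: (triangle_nonmiddle uij uik ujk) => m; apply/imsetP.
  - by exists ((j, k), i); rewrite ?inE /= ?uij ?uik ?m // -finset.setUA finset.setUC.
  - by exists ((i, k), j); rewrite ?inE /= ?(uC j i) ?uij ?ujk ?m // finset.setUAC.
  - by exists ((i, j), k); rewrite ?inE /= ?(uC k i) ?(uC k j) ?uik ?ujk ?m.
apply: leq_trans (subset_leq_card sub) _; apply: leq_trans (leq_imset_card _ _) _.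
rewrite -sum1_card.
rewrite (eq_bigl (fun t : ('I_n * 'I_n) * 'I_n => xpredT t.1 && (t.2 \in M t.1))); last first.
  by move=> t; rewrite inE.
rewrite -(pair_big_dep xpredT (fun t k => k \in M t) (fun _ _ => 1%N)) /=.
apply: (@leq_trans (\sum_(t : 'I_n * 'I_n) K)%N).
  by apply: leq_sum => t _; rewrite sum1_card HK.
by rewrite sum_nat_const card_prod card_ord mulnC -mulnn.
Qed.

End Triangles.

Lemma n_triangles_quadratic (R : realType) : exists K : nat, (0 < K)%N /\
  forall n (f : 'I_n -> 'rV[R]_5), injective f -> diam_one f ->
    (n_simplices 3 f <= K * n ^ 2)%N.
Proof.
have [K [K0 HK]] := card_nonmiddle R 5; exists K; split=> // n f f_inj [f_diam _].
by apply: n_triangles_le => // i j; rewrite -edist_le1.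
Qed.

(** * The configuration for the lower bound *)

Lemma unit_simplex_set3 (R : realType) (d n : nat) (f : 'I_n -> 'rV[R]_d) i j k :
    edist (f i) (f j) = 1 -> edist (f i) (f k) = 1 -> edist (f j) (f k) = 1 ->
  unit_simplex f [set i; j; k].
Proof.
have edistC x y : edist (f x) (f y) = edist (f y) (f x).
  by rewrite !edistE -(opprB (f y)) dotNl dotNr opprK.
move=> ij ik jk; apply/forallP => x; apply/implyP => xS; apply/forallP => y; apply/implyP => yS.
move: xS yS; rewrite !inE.
by case/orP=> [/orP[]|] /eqP->; case/orP=> [/orP[]|] /eqP->;
  rewrite ?eqxx // ?(edistC k) ?(edistC j i) ?ij ?ik ?jk eqxx implybT.
Qed.

Section LenzPoints.
Variable R : realType.

(** An injective sequence on the quarter circle of squared radius 1/2; the successor avoids division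
    by zero. *)
Definition circle_x (i : nat) : R := Num.sqrt (1 / 2 / i.+1%:R).
Definition circle_y (i : nat) : R := Num.sqrt (1 / 2 - 1 / 2 / i.+1%:R).

Definition lenz_point (i : nat) : 'rV[R]_5 :=
  \row_(k < 5) nth 0 (if i == 0%N then [:: 0; 0; 0; 0; Num.sqrt (1 / 2)]
    else if odd i then [:: circle_x i; circle_y i; 0; 0; 0]
    else [:: 0; 0; circle_x i; circle_y i; 0]) k.

Lemma circle_xy i : circle_x i * circle_x i + circle_y i * circle_y i = 1 / 2.
Proof.
have i0 : 0 < i.+1%:R :> R by rewrite ltr0n.
have i1 : 1 <= i.+1%:R :> R by rewrite ler1n.
rewrite -!expr2 !sqr_sqrtr ?subrKC //; first by rewrite subr_ge0 ler_pdivrMr; lra.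
by rewrite divr_ge0 ?ltW //; lra.
Qed.

Lemma circle_x_gt0 i : 0 < circle_x i.
Proof. by rewrite sqrtr_gt0 !divr_gt0 ?ltr0n. Qed.

Lemma circle_x_inj : injective circle_x.
Proof.
move=> i j /eqP; rewrite eqr_sqrt ?divr_ge0 ?ler0n // => /eqP.
have half0 : 1 / 2 != 0 :> R by rewrite mulf_neq0 ?invr_eq0 ?pnatr_eq0 ?oner_neq0.
move=> /(mulfI half0)/invr_inj/eqP.
by rewrite eqr_nat => /eqP[].
Qed.

Lemma lenz_point_ge0 i k : 0 <= lenz_point i ord0 k.
Proof.
have sq (x : R) : 0 <= Num.sqrt x by exact: sqrtr_ge0.
by rewrite mxE; case: ifP => _; last case: ifP => _;
  case: k => -[|[|[|[|[|//]]]]] /= _; rewrite ?sq.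
Qed.

(** This is why quarter circles are used: with all squared norms 1/2, nonnegative products mean
    distances at most 1. *)
Lemma dot_lenz_ge0 i j : 0 <= dot (lenz_point i) (lenz_point j).
Proof. by apply: sumr_ge0 => k _; rewrite mulr_ge0 ?lenz_point_ge0. Qed.

Lemma dot_lenz i : dot (lenz_point i) (lenz_point i) = 1 / 2.
Proof.
rewrite /dot !big_ord_recl big_ord0 !mxE /=.
case: ifP => _ /=; last case: ifP => _ /=; rewrite !(mul0r, addr0, add0r) ?circle_xy //.
by rewrite -expr2 sqr_sqrtr ?divr_ge0.
Qed.

Lemma dot_lenz0 i : (0 < i)%N -> dot (lenz_point 0) (lenz_point i) = 0.
Proof.
case: i => // i _; rewrite /dot !big_ord_recl big_ord0 !mxE /=.
by case: ifP => _ /=; rewrite !(mul0r, mulr0, addr0).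
Qed.

Lemma dot_lenz_odd_even i j : odd i -> (0 < j)%N -> ~~ odd j ->
  dot (lenz_point i) (lenz_point j) = 0.
Proof.
case: i j => // i [] // j oi _ oj; rewrite /dot !big_ord_recl big_ord0 !mxE /=.
by move: oi oj => /= -> /negbTE -> /=; rewrite !(mul0r, mulr0, addr0).
Qed.

Lemma lenz_point_inj : injective lenz_point.
Proof.
have neq0 t : circle_x t != 0 by rewrite gt_eqF ?circle_x_gt0.
have half : Num.sqrt (1 / 2) != 0 :> R by rewrite gt_eqF // sqrtr_gt0 divr_gt0 ?ltr0n.
move=> i j E.
have C k : lenz_point i ord0 k = lenz_point j ord0 k by rewrite E.
move: (C (@Ordinal 5 0 isT)) (C (@Ordinal 5 2 isT)) (C (@Ordinal 5 4 isT)); rewrite !mxE /=.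
case: (eqVneq i 0%N) => [->|i0]; case: (eqVneq j 0%N) => [->|j0] //=.
- by case: ifP => _ /= _ _ H; rewrite H eqxx in half.
- by case: ifP => _ /= _ _ H; rewrite -H eqxx in half.
case: ifP => _; case: ifP => _ /=.
- by move=> /circle_x_inj.
- by move=> H; have := neq0 i; rewrite H eqxx.
- by move=> H; have := neq0 j; rewrite -H eqxx.
- by move=> _ /circle_x_inj.
Qed.

Lemma lenz_dist i j : dot (lenz_point i - lenz_point j) (lenz_point i - lenz_point j) =
  1 - 2 * dot (lenz_point i) (lenz_point j).
Proof. by rewrite !dotE !dot_lenz (dotC (lenz_point j)); lra. Qed.

Definition lenz n (i : 'I_n) : 'rV[R]_5 := lenz_point i.

Lemma lenz_inj n : injective (@lenz n).
Proof. by move=> i j /lenz_point_inj/ord_inj. Qed.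

Lemma lenz_diam_one n : (1 < n)%N -> diam_one (@lenz n).
Proof.
move=> n1; split=> [i j|].
  by rewrite edist_le1 lenz_dist; have := dot_lenz_ge0 i j; lra.
exists (Ordinal (ltnW n1)), (Ordinal n1); apply/eqP.
by rewrite edist_eq1 lenz_dist dot_lenz0 // mulr0 subr0.
Qed.

(** Index 0 is the apex, and 1, ..., n contain at least [n./2] odd and [n./2] even indices. Parity
    recovers the pair from the triangle. *)
Lemma lenz_triangles n : (n./2 ^ 2 <= n_simplices 3 (@lenz n.+1))%N.
Proof.
pose a (i : 'I_n./2) : 'I_n.+1 := inord i.*2.+1.
pose b (i : 'I_n./2) : 'I_n.+1 := inord i.*2.+2.
have aE i : a i = i.*2.+1 :> nat by rewrite inordK //; have := ltn_ord i; lia.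
have bE i : b i = i.*2.+2 :> nat by rewrite inordK //; have := ltn_ord i; lia.
pose g (t : 'I_n./2 * 'I_n./2) : {set 'I_n.+1} := [set ord0; a t.1; b t.2].
have g_inj : injective g.
  move=> [i j] [i' j'] E.
  have : a i \in g (i', j') by rewrite -E !inE eqxx orbT.
  have : b j \in g (i', j') by rewrite -E !inE eqxx orbT.
  rewrite !inE -!(inj_eq val_inj) /= !aE !bE => H1 H2.
  by congr (_, _); apply: ord_inj; move: H1 H2; lia.
have -> : (n./2 ^ 2)%N = #|g @: [set: 'I_n./2 * 'I_n./2]|.
  by rewrite card_imset // cardsT card_prod card_ord mulnn.
apply: subset_leq_card; apply/fintype.subsetP => S /imsetP[[i j] _ ->]; rewrite inE /g /=.
have [n1 n2 n3] : [/\ ord0 != a i, ord0 != b j & a i != b j].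
  by split; rewrite -(inj_eq val_inj) /= ?aE ?bE //; lia.
have unitp (x y : 'I_n.+1) : dot (lenz_point x) (lenz_point y) = 0 ->
    edist (lenz x) (lenz y) = 1.
  by move=> xy; apply/eqP; rewrite edist_eq1 lenz_dist xy mulr0 subr0.
apply/andP; split.
  by rewrite finset.setUC cardsU1 !inE negb_or !(eq_sym (b j)) n2 n3 cards2 n1.
by apply: unit_simplex_set3; apply: unitp;
  rewrite ?dot_lenz0 ?dot_lenz_odd_even ?aE ?bE //= ?negbK odd_double.
Qed.

End LenzPoints.

(* DIAM(5,3,n) = Theta(n^2). *)
Theorem theorem1p11 (R : realType) :
  exists (c1 c2 : R) (N : nat), 0 < c1 /\ 0 < c2 /\
    forall n : nat, (N <= n)%N ->
      c1 * (n%:R) ^+ 2 <= DIAM R 5 3 n /\ DIAM R 5 3 n <= c2 * (n%:R) ^+ 2.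
Proof.
have [K [K0 HK]] := n_triangles_quadratic R.
(* For [n >= 4] one has n <= 4 [(n.-1)./2], whose square gives 1/16. *)
exists (1 / 16), K%:R, 4%N; split; first lra.
split=> [|n n4]; first by rewrite ltr0n.
set E : set R := fun x => exists f : 'I_n -> 'rV[R]_5,
  injective f /\ diam_one f /\ x = (n_simplices 3 f)%:R.
have E_ub : ubound E (K%:R * n%:R ^+ 2).
  by move=> _ [f [f_inj [f_diam ->]]]; rewrite -natrX -natrM ler_nat HK.
have lenzE : E (n_simplices 3 (@lenz R n))%:R.
  (* This member makes [E] nonempty for the upper bound on [sup]; the lower bound also uses that [E]
     is bounded above. *)
  by exists (@lenz R n); split; [exact: lenz_inj | split; [apply: lenz_diam_one; lia|]].
split; last by apply: ge_sup E_ub; exists (n_simplices 3 (@lenz R n))%:R.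
apply: le_trans (ub_le_sup _ lenzE); last by exists (K%:R * n%:R ^+ 2).
case: n n4 {E E_ub lenzE} => // n n4.
have tri := lenz_triangles R n.
have : (n.+1 ^ 2 <= 16 * n_simplices 3 (@lenz R n.+1))%N.
  by apply: leq_trans (_ : 16 * n./2 ^ 2 <= _)%N; [nia | rewrite leq_mul2l].
rewrite -(ler_nat R) natrX natrM; lra.
Qed.
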